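(* Let $\mathcal{H}$ be a complex Hilbert space and let $A\in\mathcal{B}(\mathcal{H})$. Then $$\frac14\|A^*A+AA^*\|\le\frac18\left[\left(\|A+A^*\|^2+\|A-A^*\|^2\right)^2+\frac12\left(\|A+A^*\|^2-\|A-A^*\|^2\right)^2\right]^{1/2}\le w^2(A).$$
   Context: $\mathcal{B}(\mathcal{H})$ is the set of bounded linear operators on $\mathcal{H}$, $A^*$ is the adjoint of $A$, and $\|\cdot\|$ is the operator norm. The numerical radius is $w(A)=\sup\{|\langle Ax,x\rangle| : x\in\mathcal{H},\ \|x\|=1\}$, and $w^2(A)=(w(A))^2$. *)

(* Defs.v *)
From HB Require Import structures.
From mathcomp Require Import all_boot all_order all_algebra.
From mathcomp Require Import sesquilinear complex.
From mathcomp Require Import boolp classical_sets functions reals.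
From mathcomp Require Import topology normedtype.

Set Implicit Arguments.
Unset Strict Implicit.
Unset Printing Implicit Defensive.

Import Order.TTheory GRing.Theory Num.Theory.

Local Open Scope classical_set_scope.
Local Open Scope complex_scope.
Local Open Scope ring_scope.

(* The inner product is linear in its first argument and conjugate-linear in
   the second, and it induces the norm for which the space is complete. *)
HB.mixin Record CompleteNormedModule_isHilbert (R : realType) H
    & CompleteNormedModule R[i] H := {
  inner : {dot H for (@Num.conj R[i])} ;
  sqr_norm_inner : forall x : H, `|x| ^+ 2 = inner x x
}.

#[short(type="hilbertType")]
HB.structure Definition Hilbert (R : realType) :=
  {H of CompleteNormedModule R[i] H & CompleteNormedModule_isHilbert R H}.

Section operators.
Context {R : realType} {H : hilbertType R}.
Implicit Types f : H -> H.

(* The library norm takes values in the nonnegative reals of R[i]; the real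
   part brings it back to R. *)
Definition hnorm (x : H) : R := complex.Re `|x|.

Definition bounded_operator f : Prop :=
  exists M : R, forall x : H, hnorm (f x) <= M * hnorm x.

Definition opnorm f : R := sup [set hnorm (f x) | x in [set x : H | hnorm x <= 1]].

(* For a bounded linear f the Riesz representation theorem makes this set
   nonempty, and positive definiteness of the inner product makes it a
   singleton. *)
Definition adjoint f : H -> H :=
  get [set g : H -> H | forall x y : H, inner (f x) y = inner x (g y)].

(* If H is the zero space there are no unit vectors, and the value is
   sup set0 = 0. *)
Definition numerical_radius f : R :=
  sup [set complex.Re `|inner (f x) x| | x in [set x : H | hnorm x = 1]].

End operators.

(* Main.v *)
Require Import Defs.
From HB Require Import structures.
From mathcomp Require Import all_boot all_order all_algebra.
From mathcomp Require Import ring lra.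
From mathcomp Require Import sesquilinear complex.
From mathcomp Require Import boolp classical_sets functions reals.
From mathcomp Require Import topology normedtype.

(** The adjoint exists by Riesz representation, obtained here by minimising the
energy [|x|^2 - 2 phi x] of a bounded real-linear functional [phi]: a minimising
sequence is Cauchy by the parallelogram identity.

Put [S = A + A*], [D = A - A*], [a = |S|], [b = |D|] and [w = w(A)].  From
[2 A*A + 2 AA* = S^2 - D^2] the left-hand side is at most [(a^2 + b^2) / 8],
which is the middle term without its second summand.
Polarization of the quadratic form [Re <Ax, x>] gives [a <= 2w]; applied to [iA]
it gives [b <= 2w].  For [p, q <= 4w^2] nonnegative,
[(p + q)^2 + (p - q)^2 / 2 <= (8w^2)^2]. *)

Import Order.TTheory GRing.Theory Num.Theory.

Local Open Scope ring_scope.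
Local Open Scope complex_scope.

Lemma Num_conjE (R : realType) (c : R[i]) : Num.conj c = conjc c.
Proof. by []. Qed.

Lemma norm_Re_le {R : realType} (c : R[i]) : `|complex.Re c| <= complex.Re `|c|.
Proof. by have := normc_ge_Re c; rewrite lecE => /andP[]. Qed.

Lemma norm_i (R : realType) : `|'i : R[i]| = 1.
Proof. by rewrite normc_def /= expr0n add0r expr1n sqrtr1. Qed.

(** A set without a supremum gets the default value 0 of [sup]; this covers the numerical radius on
    the zero space. *)
Lemma sup_ge0 (R : realType) (E : set R) : (forall r, E r -> 0 <= r) -> 0 <= sup E.
Proof.
move=> E0; case: (pselect (has_sup E)) => [[[r Er] ubE]|/sup_out -> //].
exact: le_trans (E0 r Er) (ub_le_sup ubE Er).
Qed.

(** * The underlying real inner product space *)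

Section hilbert.
Context {R : realType} {H : hilbertType R}.
Implicit Types (x y z : H) (r : R).

Definition inner_re x y : R := complex.Re (inner x y).

Lemma inner_reDl x y z : inner_re (x + y) z = inner_re x z + inner_re y z.
Proof. by rewrite /inner_re linearDl raddfD. Qed.

Lemma inner_reDr x y z : inner_re x (y + z) = inner_re x y + inner_re x z.
Proof. by rewrite /inner_re linearDr raddfD. Qed.

Lemma inner_reC x y : inner_re x y = inner_re y x.
Proof.
rewrite /inner_re (hermC inner) expr0 mul1r /= Num_conjE.
by case: (inner y x).
Qed.

Lemma inner_reZl r x y : inner_re (r%:C *: x) y = r * inner_re x y.
Proof.
rewrite /inner_re linearZl_LR /=.
by case: (inner x y) => a b /=; rewrite mul0r subr0.
Qed.

Lemma inner_reZr r x y : inner_re x (r%:C *: y) = r * inner_re x y.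
Proof. by rewrite inner_reC inner_reZl inner_reC. Qed.

Lemma inner_reNl x y : inner_re (- x) y = - inner_re x y.
Proof. by rewrite /inner_re linearNl raddfN. Qed.

Lemma inner_reNr x y : inner_re x (- y) = - inner_re x y.
Proof. by rewrite inner_reC inner_reNl inner_reC. Qed.

Lemma Re_innerZi x y : complex.Re (inner ('i *: x) y) = - complex.Im (inner x y).
Proof.
rewrite linearZl_LR /=.
by case: (inner x y) => a b /=; rewrite mul0r mul1r sub0r.
Qed.

(** Taking [c = 1] recovers the real parts and [c = 'i] the imaginary parts. *)
Lemma inner_re_eq x y z t :
  (forall c : R[i], inner_re (c *: x) y = inner_re (c *: z) t) ->
  inner x y = inner z t.
Proof.
move=> e; have := e 1; have := e 'i.
rewrite /inner_re !scale1r !Re_innerZi => /oppr_inj.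
by case: (inner x y) (inner z t) => [a b] [c d] /= -> ->.
Qed.

Lemma hnormC x : (hnorm x)%:C = `|x|.
Proof. by rewrite /hnorm RRe_real // ger0_real. Qed.

Lemma hnorm_ge0 x : 0 <= hnorm x.
Proof. by rewrite -ler0c hnormC. Qed.

Lemma hnorm_sqr x : hnorm x ^+ 2 = inner_re x x.
Proof. by rewrite /inner_re -sqr_norm_inner -hnormC -rmorphXn. Qed.

Lemma hnorm_eq0 x : (hnorm x == 0) = (x == 0).
Proof. by rewrite -(inj_eq (@complexI R)) hnormC normr_eq0. Qed.

Lemma hnorm_gt0 x : (0 < hnorm x) = (x != 0).
Proof. by rewrite lt_neqAle eq_sym hnorm_eq0 hnorm_ge0 andbT. Qed.

Lemma hnorm0 : hnorm (0 : H) = 0.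
Proof. by apply/eqP; rewrite hnorm_eq0. Qed.

Lemma hnormD x y : hnorm (x + y) <= hnorm x + hnorm y.
Proof. by rewrite -lecR rmorphD /= !hnormC ler_normD. Qed.

Lemma hnormN x : hnorm (- x) = hnorm x.
Proof. by rewrite /hnorm normrN. Qed.

Lemma hnormZC (c : R[i]) x : hnorm (c *: x) = complex.Re `|c| * hnorm x.
Proof.
by apply: complexI; rewrite hnormC normrZ normc_def rmorphM /= hnormC.
Qed.

Lemma hnormZ r x : hnorm (r%:C *: x) = `|r| * hnorm x.
Proof. by rewrite hnormZC normc_def /= expr0n addr0 sqrtr_sqr. Qed.

Lemma hnormZi x : hnorm ('i *: x) = hnorm x.
Proof. by rewrite hnormZC norm_i mul1r. Qed.

(** Cauchy-Schwarz: expand the square of the norm of [|y| x - |x| y] and divide by [2 |x| |y|]. *)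
Lemma inner_re_le x y : inner_re x y <= hnorm x * hnorm y.
Proof.
have [->|x0] := eqVneq x 0; first by rewrite hnorm0 mul0r /inner_re linear0l.
have [->|y0] := eqVneq y 0; first by rewrite hnorm0 mulr0 /inner_re linear0r.
have xgt0 : 0 < hnorm x by rewrite hnorm_gt0.
have ygt0 : 0 < hnorm y by rewrite hnorm_gt0.
have := sqr_ge0 (hnorm ((hnorm y)%:C *: x - (hnorm x)%:C *: y)).
rewrite hnorm_sqr inner_reDl !inner_reDr !(inner_reNl, inner_reNr).
rewrite !(inner_reZl, inner_reZr) -!hnorm_sqr (inner_reC y x) => h.
by rewrite -(ler_pM2l (mulr_gt0 xgt0 ygt0)); nra.
Qed.

Lemma norm_inner_re_le x y : `|inner_re x y| <= hnorm x * hnorm y.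
Proof.
by rewrite ler_norml inner_re_le lerNl -inner_reNl -(hnormN x) inner_re_le.
Qed.

Lemma hilbert_complete (u : nat -> H) :
  (forall e : R, 0 < e ->
     exists N, forall n, (N <= n)%N -> hnorm (u N - u n) < e) ->
  exists z, forall e : R, 0 < e ->
    exists N, forall n, (N <= n)%N -> hnorm (z - u n) < e.
Proof.
move=> cu.
have /cvg_ex[z uz] : cvg (u @ \oo)%classic.
  apply/cauchy_cvgP/cauchy_exP => e e0.
  (* Positivity in [R[i]] forces the imaginary part to vanish. *)
  have er : e = (complex.Re e)%:C by rewrite RRe_real ?gtr0_real.
  have [N NP] := cu (complex.Re e) ltac:(by rewrite -ltcR -er).
  exists (u N); exists N => // n /= Nn.
  by rewrite -ball_normE /= -hnormC er ltcR NP.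
exists z => e e0.
have /cvg_ballP/(_ e%:C ltac:(by rewrite ltcR)) [N _ NP] := uz.
exists N => n /NP /=.
by rewrite -ball_normE /= -hnormC ltcR.
Qed.

Lemma hnorm_sqrD x y :
  hnorm (x + y) ^+ 2 = hnorm x ^+ 2 + 2 * inner_re x y + hnorm y ^+ 2.
Proof.
rewrite !hnorm_sqr inner_reDl !inner_reDr (inner_reC y x); ring.
Qed.

(** * Riesz representation of real-linear functionals *)

Section riesz.
Variables (phi : H -> R) (K : R).
Hypothesis phiD : {morph phi : x y / x + y}.
Hypothesis phiZ : forall r x, phi (r%:C *: x) = r * phi x.
Hypothesis phi_le : forall x, phi x <= K * hnorm x.

Let J x := hnorm x ^+ 2 - 2 * phi x.

Let JD x y : J (x + y) = J x + 2 * (inner_re x y - phi y) + hnorm y ^+ 2.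
Proof. by rewrite /J hnorm_sqrD phiD; ring. Qed.

Let J_inf : has_inf (range J).
Proof.
split; first by exists (J 0), 0.
(* Complete the square: [|x|^2 - 2 K |x| = (|x| - K)^2 - K^2]. *)
exists (- K ^+ 2) => _ [x _ <-]; rewrite /J.
by have := phi_le x; have := sqr_ge0 (hnorm x - K); nra.
Qed.

Let m := inf (range J).

Let m_le x : m <= J x.
Proof. by apply: ge_inf; [exact: J_inf.2 | exists x]. Qed.

(** By the parallelogram identity the left side is [2 J x + 2 J y - 4 J ((x + y) / 2)], and the
    energy of the midpoint is at least [m]. *)
Let hnorm_sqrB_le x y : hnorm (x - y) ^+ 2 <= 2 * (J x - m) + 2 * (J y - m).
Proof.
have := m_le (2^-1%:C *: (x + y)).
rewrite /J phiZ phiD hnormZ hnorm_sqrD hnormN inner_reNr exprMn hnorm_sqrD.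
rewrite real_normK ?num_real// => h; lra.
Qed.

Lemma energy_minimizer : exists z, forall x, J z <= J x.
Proof.
have near_inf n : exists x, J x < m + n.+1%:R^-1.
  have /inf_adherent : 0 < n.+1%:R^-1 :> R by rewrite invr_gt0.
  by move=> /(_ _ J_inf)[_ [x _ <-]] ?; exists x.
have {near_inf}[u uP] := choice near_inf.
have uJ (e : R) : 0 < e -> exists N, forall n, (N <= n)%N -> J (u n) < m + e.
  move=> e0; exists (Num.truncn e^-1) => n Nn.
  apply: lt_trans (uP n) _; rewrite ltrD2l.
  rewrite -(invrK e) ltf_pV2 ?posrE ?invr_gt0 ?ltr0n//.
  by apply: lt_le_trans (truncnS_gt _) _; rewrite ler_nat.
have [z zP] : exists z, forall e : R, 0 < e ->
    exists N, forall n, (N <= n)%N -> hnorm (z - u n) < e.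
  apply: hilbert_complete => e e0.
  (* Two energies within [e^2 / 4] of [m] put their points within [e] of each other, by
     [hnorm_sqrB_le]. *)
  have [N NP] := uJ (e ^+ 2 / 4) ltac:(by rewrite divr_gt0 ?exprn_gt0).
  exists N => n Nn.
  rewrite -(@ltr_pXn2r _ 2) ?nnegrE ?hnorm_ge0 ?ltW//.
  apply: le_lt_trans (hnorm_sqrB_le _ _) _.
  by have := NP N (leqnn N); have := NP n Nn; lra.
exists z => x; apply: (le_trans _ (m_le x)).
apply/ler_addgt0Pr => e e0.
(* By [JD], [J z] exceeds [J (u n)] by at most [2 (|z| + |K|) |z - u n|]; the added 1 keeps [C]
   positive for the division. *)
pose C := 2 * (hnorm z + `|K|) + 1.
have C0 : 0 < C by rewrite ltr_wpDl// mulr_ge0// addr_ge0 ?hnorm_ge0.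
have [N NP] := uJ (e / 2) ltac:(by rewrite divr_gt0).
have [N' NP'] := zP (e / (2 * C)) ltac:(by rewrite divr_gt0 ?mulr_gt0).
set n := maxn N N'.
have := NP' n (leq_maxr _ _); have := NP n (leq_maxl _ _).
have := JD z (u n - z); rewrite addrC subrK => ->.
rewrite ltr_pdivlMr ?mulr_gt0// /C.
have := norm_inner_re_le z (u n - z); have := phi_le (u n - z).
have -> : hnorm (u n - z) = hnorm (z - u n) by rewrite -hnormN opprB.
rewrite ler_norml => h3 /andP[h4 _].
have := hnorm_ge0 (z - u n); have := ler_norm K.
by nra.
Qed.

Lemma riesz_re : exists z, forall x, phi x = inner_re x z.
Proof.
have [z zP] := energy_minimizer; exists z => x.
pose d := inner_re z x - phi x; pose q := hnorm x ^+ 2.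
have q0 : 0 <= q by rewrite exprn_ge0 ?hnorm_ge0.
have q1 : 0 < q + 1 by rewrite ltr_wpDl.
(* First variation along [x]: the step [t = - d / (q + 1)] changes the energy by [2 t d + t^2 q],
   which is negative unless [d = 0]. The denominator [q + 1] stays positive even at [x = 0]. *)
have := zP (z + (- (d / (q + 1)))%:C *: x).
rewrite JD inner_reZr phiZ hnormZ exprMn real_normK ?num_real//.
rewrite -mulrBr -/d -/q -addrA lerDl.
have -> : 2 * (- (d / (q + 1)) * d) + (- (d / (q + 1))) ^+ 2 * q
    = - (d ^+ 2 * ((q + 2) / (q + 1) ^+ 2)) by field; lra.
rewrite oppr_ge0 pmulr_lle0; last by rewrite divr_gt0 ?exprn_gt0//; lra.
move=> d0; have /eqP : d ^+ 2 = 0 by apply/eqP; rewrite eq_le d0 sqr_ge0.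
by rewrite sqrf_eq0 /d subr_eq0 inner_reC => /eqP ->.
Qed.

End riesz.

(** Multiplying [x] by the conjugate of [c] makes the inner product the real number [|c|^2], so the
    real Cauchy-Schwarz inequality applies. *)
Lemma norm_inner_le x y : complex.Re `|inner x y| <= hnorm x * hnorm y.
Proof.
set c := inner x y.
have [->|c0] := eqVneq c 0; first by rewrite normr0 mulr_ge0 ?hnorm_ge0.
have cgt0 : 0 < complex.Re `|c|.
  by rewrite -ltcR RRe_real ?ger0_real// normr_gt0.
have cx_y : inner_re (c^* *: x) y = complex.Re `|c| ^+ 2.
  rewrite /inner_re linearZl_LR -/c mulrC -sqr_normc.
  by rewrite normc_def -rmorphXn.
rewrite -(ler_pM2l cgt0) mulrA -expr2 -cx_y.
by apply: le_trans (inner_re_le _ _) _; rewrite hnormZC normcJ.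
Qed.

(** * Adjoint pairs and existence of the adjoint *)

(** A relation between bare functions, so that it also applies to the explicit pair ['i A],
    [- 'i A*]. *)
Definition adjoint_pair (f g : H -> H) : Prop :=
  forall x y, inner (f x) y = inner x (g y).

Lemma inner_re_inj y z : (forall x, inner_re x y = inner_re x z) -> y = z.
Proof.
move=> yz; apply/eqP; rewrite -subr_eq0 -hnorm_eq0 -sqrf_eq0 hnorm_sqr.
by rewrite inner_reDr inner_reNr yz subrr.
Qed.

Section adjoint_pair.
Context {f g : H -> H} (fg : adjoint_pair f g).

Lemma adjoint_pair_re x y : inner_re (f x) y = inner_re x (g y).
Proof. by rewrite /inner_re fg. Qed.

Lemma adjoint_pairD : {morph g : x y / x + y}.
Proof.
move=> x y; apply: inner_re_inj => z.
by rewrite inner_reDr -!adjoint_pair_re inner_reDr.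
Qed.

Lemma adjoint_pairZ r x : g (r%:C *: x) = r%:C *: g x.
Proof.
apply: inner_re_inj => z.
by rewrite inner_reZr -!adjoint_pair_re inner_reZr.
Qed.

(** Divide [|g x|^2 = Re <f (g x), x> <= M |g x| |x|] by [|g x|]. The sign of [M] is not given, so
    the case [g x = 0] gets [0 <= M |x|] from the bound on [f x]. *)
Lemma adjoint_pair_bounded : bounded_operator f -> bounded_operator g.
Proof.
move=> [M fM]; exists M => x.
have [->|gx0] := eqVneq (g x) 0.
  by rewrite hnorm0; apply: le_trans (hnorm_ge0 (f x)) (fM x).
have gx_gt0 : 0 < hnorm (g x) by rewrite hnorm_gt0.
rewrite -(ler_pM2l gx_gt0) -expr2 hnorm_sqr -adjoint_pair_re.
apply: le_trans (inner_re_le _ _) _.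
by rewrite mulrA [hnorm _ * M]mulrC ler_wpM2r ?hnorm_ge0.
Qed.

End adjoint_pair.

(** The sum of this pair is ['i (f - g)], which turns bounds on sums into bounds on differences. *)
Lemma adjoint_pair_i (f g : H -> H) : adjoint_pair f g ->
  adjoint_pair (fun x => 'i *: f x) (fun x => - 'i *: g x).
Proof.
move=> fg x y /=.
have -> : inner ('i *: f x) y = 'i * inner (f x) y by rewrite linearZl_LR.
rewrite fg linearZr_LR /= Num_conjE; congr (_ * _).
by apply/eqP; rewrite eq_complex /= oppr0 opprK !eqxx.
Qed.

Lemma adjointP {A : {linear H -> H}} :
  bounded_operator A -> adjoint_pair A (adjoint A).
Proof.
move=> [M AM].
suff [g gP] : exists g, adjoint_pair A g.
  exact: (@getPex _ [set g : H -> H | adjoint_pair A g]%classic (ex_intro _ g gP)).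
have riesz y : exists z, forall x, inner (A x) y = inner x z.
  have [z zP] : exists z, forall x, inner_re (A x) y = inner_re x z.
    apply: (@riesz_re _ (M * hnorm y)) => [x x'|r x|x].
    - by rewrite linearD inner_reDl.
    - by rewrite linearZ inner_reZl.
    - apply: le_trans (inner_re_le _ _) _.
      by rewrite mulrAC ler_wpM2r ?hnorm_ge0.
  (* Complex linearity of [A] upgrades the real identity: apply it to [c *: x] for every [c]. *)
  by exists z => x; apply: inner_re_eq => c; rewrite -linearZ.
by have [g gP] := choice riesz; exists g => x y; apply: gP.
Qed.

(** * Bounds by the operator norm and the numerical radius *)

Lemma opnorm_le (f : H -> H) (C : R) : 0 <= C ->
  (forall x, hnorm (f x) <= C * hnorm x) -> opnorm f <= C.
Proof.
move=> C0 fC; apply: ge_sup => [|_ [x /= x1 <-]].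
  by exists (hnorm (f 0)), 0 => //=; rewrite hnorm0.
by apply: le_trans (fC x) _; rewrite -[leRHS]mulr1 ler_wpM2l.
Qed.

Lemma opnorm_ubound {f : H -> H} : bounded_operator f ->
  has_ubound [set hnorm (f x) | x in [set x : H | hnorm x <= 1]]%classic.
Proof.
move=> [M fM]; exists `|M| => _ [x /= x1 <-].
apply: le_trans (fM x) _; apply: le_trans (ler_norm _) _.
by rewrite normrM -[leRHS]mulr1 ler_wpM2l// ger0_norm ?hnorm_ge0.
Qed.

Lemma opnorm_ge0 (f : H -> H) : 0 <= opnorm f.
Proof. by apply: sup_ge0 => _ [x _ <-]; apply: hnorm_ge0. Qed.

(** Rescale [x] to norm 1. Homogeneity is asked for real scalars only, as [adjoint_pairZ] supplies
    it. *)
Lemma le_opnorm {f : H -> H} : bounded_operator f ->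
  (forall r x, f (r%:C *: x) = r%:C *: f x) ->
  forall x, hnorm (f x) <= opnorm f * hnorm x.
Proof.
move=> /opnorm_ubound fM fZ x.
have [->|x0] := eqVneq x 0.
  by have /= := fZ 0 0; rewrite !scale0r => ->; rewrite hnorm0 mulr0.
have xgt0 : 0 < hnorm x by rewrite hnorm_gt0.
have xV0 : 0 <= (hnorm x)^-1 by rewrite invr_ge0 hnorm_ge0.
rewrite -ler_pdivrMr// mulrC -(ger0_norm xV0) -hnormZ -fZ.
apply: ub_le_sup => //; exists ((hnorm x)^-1%:C *: x) => //=.
by rewrite hnormZ ger0_norm// mulVf ?gt_eqF.
Qed.

Lemma bounded_operatorD {f g : H -> H} :
  bounded_operator f -> bounded_operator g -> bounded_operator (f \+ g).
Proof.
move=> [M fM] [N gN]; exists (M + N) => x; rewrite mulrDl.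
by apply: le_trans (hnormD _ _) _; apply: lerD.
Qed.

Lemma bounded_operatorB {f g : H -> H} :
  bounded_operator f -> bounded_operator g -> bounded_operator (f \- g).
Proof.
move=> [M fM] [N gN]; exists (M + N) => x; rewrite mulrDl.
by apply: le_trans (hnormD _ _) _; rewrite hnormN lerD.
Qed.

Lemma norm_inner_le_numerical_radius {A : {linear H -> H}} (x : H) :
  bounded_operator A ->
  complex.Re `|inner (A x) x| <= numerical_radius A * hnorm x ^+ 2.
Proof.
move=> [M AM].
have [->|x0] := eqVneq x 0.
  by rewrite linear0r normr0 hnorm0 expr0n mulr0.
have xgt0 : 0 < hnorm x by rewrite hnorm_gt0.
pose y := (hnorm x)^-1%:C *: x.
have xV0 : 0 <= (hnorm x)^-1 by rewrite invr_ge0 hnorm_ge0.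
have y1 : hnorm y = 1 by rewrite hnormZ ger0_norm// mulVf ?gt_eqF.
have xy : x = (hnorm x)%:C *: y.
  by rewrite scalerA -rmorphM divff ?gt_eqF// rmorph1 scale1r.
have quad r : inner (A (r%:C *: y)) (r%:C *: y) = (r ^+ 2)%:C * inner (A y) y.
  have -> : A (r%:C *: y) = r%:C *: A y by rewrite linearZ.
  rewrite linearZr_LR linearZl_LR /= Num_conjE conjc_real.
  by rewrite mulrA -rmorphM -expr2.
have -> : complex.Re `|inner (A x) x| = complex.Re `|inner (A y) y| * hnorm x ^+ 2.
  rewrite {1 2}xy quad normrM (@ger0_norm _ _%:C) ?ler0c ?sqr_ge0//.
  by rewrite normc_def -rmorphM mulrC.
rewrite ler_wpM2r ?sqr_ge0//; apply: ub_le_sup; last by exists y.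
exists M => _ [z /= z1 <-]; apply: le_trans (norm_inner_le _ _) _.
by rewrite z1 mulr1; have := AM z; rewrite z1 mulr1.
Qed.

Lemma numerical_radius_ge0 (f : H -> H) : 0 <= numerical_radius f.
Proof. by apply: sup_ge0 => _ [x _ <-]; apply: le_trans (norm_Re_le _). Qed.

(** With [Q x = Re <f x, x>], adjointness gives [Q (x + y) - Q (x - y) = 2 Re <f x + g x, y>], and
    the parallelogram identity bounds the left side by [2 w (|x|^2 + |y|^2)]. *)
Lemma polarization_bound {f g : H -> H} {w : R} : 0 <= w ->
  adjoint_pair f g -> {morph f : x y / x + y} -> {morph f : x / - x} ->
  (forall x, `|inner_re (f x) x| <= w * hnorm x ^+ 2) ->
  forall x, hnorm (f x + g x) <= 2 * w * hnorm x.
Proof.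
move=> w0 fg fD fN fw x; set u := f x + g x.
have key y : inner_re u y <= w * (hnorm x ^+ 2 + hnorm y ^+ 2).
  have := fw (x + y); have := fw (x - y).
  rewrite !fD fN !ler_norml => /andP[+ _] /andP[_ +].
  rewrite !hnorm_sqrD hnormN !inner_reDl !inner_reDr !(inner_reNl, inner_reNr).
  rewrite (adjoint_pair_re fg y x) (inner_reC y (g x)) => h1 h2; lra.
have [->|u0] := eqVneq u 0.
  by rewrite hnorm0 !mulr_ge0 ?hnorm_ge0.
have ugt0 : 0 < hnorm u by rewrite hnorm_gt0.
(* The optimal [y]: parallel to [u], with the norm of [x]. It gives [|x| |u| <= 2 w |x|^2]. *)
have := key ((hnorm x / hnorm u)%:C *: u).
rewrite inner_reZr -hnorm_sqr hnormZ ger0_norm ?divr_ge0 ?hnorm_ge0//.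
rewrite divfK ?gt_eqF// expr2 mulrA divfK ?gt_eqF//.
have [x0|x0] := eqVneq x 0.
  (* Additivity makes [f 0] and [g 0] vanish, contradicting [u != 0]. *)
  case/eqP: u0; rewrite /u x0.
  have /(canRL (addrK _)) := esym (fD 0 0); rewrite addr0 subrr => ->.
  have /(canRL (addrK _)) := esym (adjoint_pairD fg 0 0); rewrite addr0 subrr => ->.
  by rewrite addr0.
have xgt0 : 0 < hnorm x by rewrite hnorm_gt0.
by move=> h; rewrite -(ler_pM2l xgt0); lra.
Qed.

End hilbert.

Theorem theorem2p18 (R : realType) (H : hilbertType R) (A : {linear H -> H})
    (hA : bounded_operator A) :
  4^-1 * opnorm ((adjoint A \o A) \+ (A \o adjoint A))
    <= 8^-1 * Num.sqrt
         ((opnorm (A \+ adjoint A) ^+ 2 + opnorm (A \- adjoint A) ^+ 2) ^+ 2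
          + 2^-1 * (opnorm (A \+ adjoint A) ^+ 2
                    - opnorm (A \- adjoint A) ^+ 2) ^+ 2)
  /\
  8^-1 * Num.sqrt
         ((opnorm (A \+ adjoint A) ^+ 2 + opnorm (A \- adjoint A) ^+ 2) ^+ 2
          + 2^-1 * (opnorm (A \+ adjoint A) ^+ 2
                    - opnorm (A \- adjoint A) ^+ 2) ^+ 2)
    <= numerical_radius A ^+ 2.
Proof.
have AA := adjointP hA.
have hB := adjoint_pair_bounded AA hA.
have BD := adjoint_pairD AA; have BZ := adjoint_pairZ AA.
have AD : {morph A : x y / x + y} by exact: linearD.
have AN : {morph A : x / - x} by exact: linearN.
have BN x : adjoint A (- x) = - adjoint A x.
  by rewrite -(scaleN1r x) -(rmorphN1 (real_complex R)) BZ rmorphN1 scaleN1r.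
set B := adjoint A in AA hB BD BZ BN *.
have hS := bounded_operatorD hA hB; have hD := bounded_operatorB hA hB.
have leS x : hnorm (A x + B x) <= opnorm (A \+ B) * hnorm x.
  by apply: (le_opnorm hS) => r y /=; rewrite linearZ BZ scalerDr.
have leD x : hnorm (A x - B x) <= opnorm (A \- B) * hnorm x.
  by apply: (le_opnorm hD) => r y /=; rewrite linearZ BZ scalerBr.
have a0 := opnorm_ge0 (A \+ B); have b0 := opnorm_ge0 (A \- B).
set a := opnorm (A \+ B) in leS a0 *; set b := opnorm (A \- B) in leD b0 *.
set w := numerical_radius A.
set S := Num.sqrt _.
have S0 : 0 <= S by exact: sqrtr_ge0.
have S2 : S ^+ 2 = (a ^+ 2 + b ^+ 2) ^+ 2 + 2^-1 * (a ^+ 2 - b ^+ 2) ^+ 2.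
  rewrite sqr_sqrtr//; apply: addr_ge0; first exact: sqr_ge0.
  by rewrite mulr_ge0 ?invr_ge0 ?sqr_ge0.
split.
  have AABB x : B (A x) + A (B x) =
      2^-1%:C *: ((A (A x + B x) + B (A x + B x)) - (A (A x - B x) - B (A x - B x))).
    rewrite !BD !AD !BN !AN !opprD !opprK [in RHS]addrACA.
    rewrite (addrACA (A (A x))) subrr add0r (addrACA (B (A x))) subrr addr0.
    rewrite -addrACA [A _ + _]addrC scalerDr -scalerDl -rmorphD.
    by rewrite (_ : 2^-1 + 2^-1 = 1 :> R) ?rmorph1 ?scale1r//; lra.
  have : opnorm ((B \o A) \+ (A \o B)) <= (a ^+ 2 + b ^+ 2) / 2.
    apply: opnorm_le => [|x]; first by rewrite divr_ge0 ?addr_ge0 ?sqr_ge0.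
    rewrite /= AABB hnormZ ger0_norm ?invr_ge0//.
    have := hnormD (A (A x + B x) + B (A x + B x)) (- (A (A x - B x) - B (A x - B x))).
    rewrite hnormN.
    (* Each bound is used twice: [|S (S x)| <= a |S x| <= a^2 |x|], and likewise for [D] with
       [b]. *)
    have := leS (A x + B x); have := leD (A x - B x).
    have := ler_wpM2l a0 (leS x); have := ler_wpM2l b0 (leD x); lra.
  suff : a ^+ 2 + b ^+ 2 <= S by lra.
  rewrite -(@ler_pXn2r _ 2) ?nnegrE ?addr_ge0 ?sqr_ge0// S2 lerDl.
  by rewrite mulr_ge0 ?invr_ge0 ?sqr_ge0.
have w0 : 0 <= w by exact: numerical_radius_ge0.
have aw : a <= 2 * w.
  apply: opnorm_le => [|x]; first by rewrite mulr_ge0.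
  apply: polarization_bound => // y.
  apply: le_trans (norm_inner_le_numerical_radius y hA).
  exact: norm_Re_le.
have bw : b <= 2 * w.
  apply: opnorm_le => [|x]; first by rewrite mulr_ge0.
  (* Multiplication by ['i] preserves the norm and turns [A x - B x] into the sum of an adjoint
     pair. *)
  rewrite -hnormZi scalerBr -scaleNr.
  apply: (@polarization_bound _ _ (fun x => 'i *: A x) (fun x => - 'i *: B x)) => //.
  - exact: adjoint_pair_i.
  - by move=> y z; rewrite AD scalerDr.
  - by move=> y; rewrite AN scalerN.
  move=> y; apply: le_trans (norm_inner_le_numerical_radius y hA).
  by apply: le_trans (norm_Re_le _) _; rewrite linearZl_LR normrM norm_i mul1r.
suff : S <= 8 * w ^+ 2 by lra.
have w2 : 0 <= 8 * w ^+ 2 by rewrite mulr_ge0 ?sqr_ge0.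
rewrite -(@ler_pXn2r _ 2) ?nnegrE ?sqr_ge0// S2.
have a2 : a ^+ 2 <= 4 * w ^+ 2 by nra.
have b2 : b ^+ 2 <= 4 * w ^+ 2 by nra.
have := sqr_ge0 a; have := sqr_ge0 b.
(* The left side is [(3 p^2 + 2 p q + 3 q^2) / 2], increasing in [p, q >= 0] and equal to [64 v^2]
   at [p = q = 4 v]. *)
move: a2 b2; move: (a ^+ 2) (b ^+ 2) (w ^+ 2) => p q v; nra.
Qed.
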